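(* Let $\vec G=(G_0,\dots,G_n)$ be an fgv. Then $\vec G$ is compact if and only if $\vec G$ is rectifying.
   Context: Untyped $\lambda$-calculus; $=$ denotes $\beta$-conversion. $M\vec G=MG_0\cdots G_n$; $F^k(z)=F(F(\cdots F(z)\cdots))$ with $k$ copies of $F$. $M=^\infty N$ means $M$ and $N$ have the same Böhm tree. $Y$ is an fpc if $Yx=x(Yx)$ for $x$ not free in $Y$, a wfpc if $Yx=^\infty x(Yx)$; $\mathsf{FPC},\mathsf{WFPC}$ are the sets of these. $\vec G$ is an fgv if $Y\in\mathsf{FPC}\Rightarrow Y\vec G\in\mathsf{FPC}$. $\vec G$ is compact if, for a variable $z$ not free in $\vec G$, there is $k\ge0$ with $G_0^k(z)G_1\cdots G_n\in\mathsf{FPC}$. $\vec G$ is rectifying if $Y\in\mathsf{WFPC}$ implies $Y\vec G\in\mathsf{FPC}$. *)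

(* Defs.v *)
From Stdlib Require Import Arith List Relations.
Import ListNotations.

(** Untyped lambda terms (possibly open), modulo alpha, in de Bruijn form:
    under [d] enclosing abstractions the free variable [x] is [Var (d + x)]. *)
Inductive term : Type :=
| Var (x : nat)
| App (M N : term)
| Lam (M : term).

Definition scons {A : Type} (a : A) (f : nat -> A) (x : nat) : A :=
  match x with 0 => a | S x => f x end.

Fixpoint rename (r : nat -> nat) (M : term) : term :=
  match M with
  | Var x => Var (r x)
  | App M N => App (rename r M) (rename r N)
  | Lam M => Lam (rename (scons 0 (fun x => S (r x))) M)
  end.

Definition up (s : nat -> term) : nat -> term :=
  scons (Var 0) (fun x => rename S (s x)).

Fixpoint subst (s : nat -> term) (M : term) : term :=
  match M with
  | Var x => s x
  | App M N => App (subst s M) (subst s N)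
  | Lam M => Lam (subst (up s) M)
  end.

Fixpoint free (x : nat) (M : term) : Prop :=
  match M with
  | Var y => x = y
  | App M N => free x M \/ free x N
  | Lam M => free (S x) M
  end.

Inductive beta : term -> term -> Prop :=
| beta_redex M N : beta (App (Lam M) N) (subst (scons N Var) M)
| beta_appl M M' N : beta M M' -> beta (App M N) (App M' N)
| beta_appr M N N' : beta N N' -> beta (App M N) (App M N')
| beta_lam M M' : beta M M' -> beta (Lam M) (Lam M').

Definition conv : term -> term -> Prop := clos_refl_sym_trans term beta.

Definition apps (M : term) (Ns : list term) : term := fold_left App Ns M.

Definition lams (n : nat) (M : term) : term := Nat.iter n Lam M.

(** [hnf_of M n y Ns]: [M] has head normal form
    λx_1 ... x_n. y N_1 ... N_m (up to conversion). *)
Definition hnf_of (M : term) (n y : nat) (Ns : list term) : Prop :=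
  conv M (lams n (apps (Var y) Ns)).

Definition has_hnf (M : term) : Prop := exists n y Ns, hnf_of M n y Ns.

(** Labels of Boehm tree nodes: bottom, or a prefix of [n] abstractions with
    head variable [y] (a de Bruijn index under these), and [m] subtrees. *)
Inductive label : Type :=
| Bot
| Node (n y m : nat).

(** The Boehm tree of [M], as (the graph of) a partial function from positions
    to labels.  By confluence, a head normal form is determined up to conversion
    of the arguments, so each position carries at most one label. *)
Inductive bohm_tree : term -> list nat -> label -> Prop :=
| bt_bot M : ~ has_hnf M -> bohm_tree M [] Bot
| bt_root M n y Ns :
    hnf_of M n y Ns -> bohm_tree M [] (Node n y (length Ns))
| bt_child M n y Ns i N p l :
    hnf_of M n y Ns -> nth_error Ns i = Some N ->
    bohm_tree N p l -> bohm_tree M (i :: p) l.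

Definition bohm_eq (M N : term) : Prop :=
  forall p l, bohm_tree M p l <-> bohm_tree N p l.

Definition fpc (Y : term) : Prop :=
  forall x, ~ free x Y -> conv (App Y (Var x)) (App (Var x) (App Y (Var x))).

Definition wfpc (Y : term) : Prop :=
  forall x, ~ free x Y -> bohm_eq (App Y (Var x)) (App (Var x) (App Y (Var x))).

(** A vector [G_0, ..., G_n] is never empty: it is given by its head [G0] and
    the list [Gs] of [G_1, ..., G_n]. *)
Definition fgv (G0 : term) (Gs : list term) : Prop :=
  forall Y, fpc Y -> fpc (apps Y (G0 :: Gs)).

Definition compact (G0 : term) (Gs : list term) : Prop :=
  forall z, Forall (fun G => ~ free z G) (G0 :: Gs) ->
  exists k, fpc (apps (Nat.iter k (App G0) (Var z)) Gs).

Definition rectifying (G0 : term) (Gs : list term) : Prop :=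
  forall Y, wfpc Y -> fpc (apps Y (G0 :: Gs)).

(* Main.v *)
(** If [Y] is a wfpc, then [Y x = x^k N] for every [k], so [Y G_0 ... G_n] is a
    substitution instance of [G_0^k(z) G_1 ... G_n]; hence compact vectors are
    rectifying.

    Conversely, let [z] be fresh and [A = λc a x. x (a (z c) a x)].  The term
    [Y = A z A] satisfies [A c A x = x (A (z c) A x)], so it is a wfpc whose
    unfoldings carry pairwise distinct counters [c = z (z (... z))].  If
    [Y G_0 ... G_n x = x (Y G_0 ... G_n x)], confluence gives a common reduct,
    and the two reductions to it use only finitely many unfoldings, say fewer
    than [K].  Replacing each [A c A] whose counter has [i] applications by
    [λx. x^(K-i)(z)] turns both reductions into valid conversions, and since [z]
    does not occur in the [G_i] the counters make this replacement a function of
    the common reduct.  Thus [G_0^K(z) G_1 ... G_n] is an fpc. *)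

Require Import Defs.
From Stdlib Require Import List.
From Stdlib Require Import Arith Lia Relations Setoid Morphisms.
Import ListNotations.

(** * Substitution *)

Lemma subst_ext_free M : forall s t,
  (forall x, free x M -> s x = t x) -> subst s M = subst t M.
Proof.
  induction M as [x|M IHM N IHN|M IHM]; simpl; intros s t H.
  - now apply H.
  - rewrite (IHM s t), (IHN s t); auto.
  - f_equal. apply IHM. intros [|x] Hx; simpl; [easy|]. now rewrite H.
Qed.

Lemma subst_ext M s t : (forall x, s x = t x) -> subst s M = subst t M.
Proof. intros H. apply subst_ext_free. auto. Qed.

Lemma rename_as_subst M : forall r, rename r M = subst (fun x => Var (r x)) M.
Proof.
  induction M as [x|M IHM N IHN|M IHM]; simpl; intros r; f_equal; auto.
  rewrite IHM. apply subst_ext. now intros [|x].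
Qed.

Lemma subst_Var M : subst Var M = M.
Proof.
  induction M as [x|M IHM N IHN|M IHM]; simpl; f_equal; auto.
  rewrite <- IHM at 2. apply subst_ext. now intros [|x].
Qed.

Lemma subst_rename M : forall s r, subst s (rename r M) = subst (fun x => s (r x)) M.
Proof.
  induction M as [x|M IHM N IHN|M IHM]; simpl; intros s r; f_equal; auto.
  rewrite IHM. apply subst_ext. now intros [|x].
Qed.

Lemma rename_subst M : forall r s, rename r (subst s M) = subst (fun x => rename r (s x)) M.
Proof.
  induction M as [x|M IHM N IHN|M IHM]; simpl; intros r s; f_equal; auto.
  rewrite IHM. apply subst_ext. intros [|x]; simpl; [easy|].
  now rewrite (rename_as_subst (rename S (s x))), (rename_as_subst (rename r (s x))), !subst_rename.
Qed.

Lemma subst_subst M : forall s t, subst t (subst s M) = subst (fun x => subst t (s x)) M.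
Proof.
  induction M as [x|M IHM N IHN|M IHM]; simpl; intros s t; f_equal; auto.
  rewrite IHM. apply subst_ext. intros [|x]; simpl; [easy|].
  rewrite subst_rename, rename_subst. now apply subst_ext.
Qed.

Lemma subst_up_scons s M N :
  subst s (subst (scons N Var) M) = subst (scons (subst s N) Var) (subst (up s) M).
Proof.
  rewrite !subst_subst. apply subst_ext. intros [|x]; simpl; [easy|].
  rewrite subst_rename. symmetry. apply subst_Var.
Qed.

Lemma free_bound M : exists b, forall x, free x M -> x < b.
Proof.
  induction M as [x|M [b Hb] N [c Hc]|M [b Hb]]; simpl.
  - exists (S x). lia.
  - exists (b + c). intros x [H|H]; [apply Hb in H|apply Hc in H]; lia.
  - exists b. intros x H. apply Hb in H. lia.
Qed.

Lemma fresh_var Ms : exists x, Forall (fun M => ~ free x M) Ms.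
Proof.
  assert (H : exists b, forall x, b <= x -> Forall (fun M => ~ free x M) Ms).
  { induction Ms as [|M Ms [b Hb]]; [exists 0; auto|].
    destruct (free_bound M) as [c Hc]. exists (b + c). intros x Hx. constructor.
    - intros H. apply Hc in H. lia.
    - apply Hb. lia. }
  destruct H as [b Hb]. exists b. auto.
Qed.

(** Unlike [scons N Var], which contracts a redex and lowers the indices, this substitution leaves
    every other free variable in place, as with named variables. *)
Definition single (x : nat) (N : term) (y : nat) : term :=
  if Nat.eq_dec y x then N else Var y.

Lemma single_eq x N : single x N x = N.
Proof. unfold single. now destruct Nat.eq_dec. Qed.

Lemma single_neq x y N : y <> x -> single x N y = Var y.
Proof. unfold single. now destruct Nat.eq_dec. Qed.

Lemma subst_single_fresh x N M : ~ free x M -> subst (single x N) M = M.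
Proof.
  intros H. rewrite <- (subst_Var M) at 2. apply subst_ext_free. intros y Hy.
  apply single_neq. congruence.
Qed.

Lemma subst_apps s Ns : forall M, subst s (apps M Ns) = apps (subst s M) (map (subst s) Ns).
Proof. induction Ns as [|N Ns IH]; intros M; simpl; [easy|]. apply (IH (App M N)). Qed.

Lemma subst_iter s F M k :
  subst s (Nat.iter k (App F) M) = Nat.iter k (App (subst s F)) (subst s M).
Proof. induction k; simpl; f_equal; auto. Qed.

Lemma free_apps x Ns : forall M, free x (apps M Ns) <-> free x M \/ Exists (free x) Ns.
Proof.
  induction Ns as [|N Ns IH]; intros M; simpl.
  - rewrite Exists_nil. tauto.
  - rewrite (IH (App M N)), Exists_cons. simpl. tauto.
Qed.

Lemma free_iter x F M k : free x (Nat.iter k (App F) M) -> free x F \/ free x M.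
Proof. induction k; simpl; tauto. Qed.

Lemma map_subst_single_fresh x N Ms :
  Forall (fun M => ~ free x M) Ms -> map (subst (single x N)) Ms = Ms.
Proof. induction 1; simpl; f_equal; auto. now apply subst_single_fresh. Qed.

(** * Confluence *)

Notation red := (clos_refl_trans term beta).

#[local] Instance red_preorder : PreOrder red.
Proof. split; [exact (rt_refl _ _)|exact (rt_trans _ _)]. Qed.

#[local] Instance conv_equiv : Equivalence conv.
Proof. split; [exact (rst_refl _ _)|exact (rst_sym _ _)|exact (rst_trans _ _)]. Qed.

#[local] Instance App_red : Proper (red ==> red ==> red) App.
Proof.
  intros M M' HM N N' HN. transitivity (App M' N).
  - clear HN. induction HM; [apply rt_step; now constructor|reflexivity|etransitivity; eassumption].
  - clear HM. induction HN; [apply rt_step; now constructor|reflexivity|etransitivity; eassumption].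
Qed.

#[local] Instance Lam_red : Proper (red ==> red) Lam.
Proof.
  intros M M' HM.
  induction HM; [apply rt_step; now constructor|reflexivity|etransitivity; eassumption].
Qed.

#[local] Instance App_conv : Proper (conv ==> conv ==> conv) App.
Proof.
  intros M M' HM N N' HN. transitivity (App M' N).
  - clear HN. induction HM; [apply rst_step; now constructor|reflexivity|now symmetry|etransitivity; eassumption].
  - clear HM. induction HN; [apply rst_step; now constructor|reflexivity|now symmetry|etransitivity; eassumption].
Qed.

#[local] Instance Lam_conv : Proper (conv ==> conv) Lam.
Proof.
  intros M M' HM.
  induction HM; [apply rst_step; now constructor|reflexivity|now symmetry|etransitivity; eassumption].
Qed.

Lemma red_conv M N : red M N -> conv M N.
Proof. exact (clos_rt_clos_rst _ _ M N). Qed.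

Lemma beta_conv M N P : P = subst (scons N Var) M -> conv (App (Lam M) N) P.
Proof. intros ->. apply rst_step, beta_redex. Qed.

Lemma beta_subst M N : beta M N -> forall s, beta (subst s M) (subst s N).
Proof.
  induction 1; simpl; intros s; try (constructor; auto; fail).
  rewrite subst_up_scons. apply beta_redex.
Qed.

Lemma conv_subst s M N : conv M N -> conv (subst s M) (subst s N).
Proof.
  induction 1; [apply rst_step; now apply beta_subst|reflexivity|now symmetry|etransitivity; eassumption].
Qed.

Lemma conv_apps Ns : forall M M', conv M M' -> conv (apps M Ns) (apps M' Ns).
Proof.
  induction Ns as [|N Ns IH]; intros M M' H; simpl; [easy|].
  apply (IH (App M N) (App M' N)). now rewrite H.
Qed.

(** Parallel reduction in the style of Tait and Martin-Löf: it lies between [beta] and [red], so its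
    confluence carries over. *)
Inductive par : term -> term -> Prop :=
| par_var x : par (Var x) (Var x)
| par_app M M' N N' : par M M' -> par N N' -> par (App M N) (App M' N')
| par_lam M M' : par M M' -> par (Lam M) (Lam M')
| par_beta M M' N N' :
    par M M' -> par N N' -> par (App (Lam M) N) (subst (scons N' Var) M').

Lemma par_refl M : par M M.
Proof. induction M; now constructor. Qed.

Lemma beta_par M N : beta M N -> par M N.
Proof. induction 1; constructor; auto using par_refl. Qed.

Lemma par_red M N : par M N -> red M N.
Proof.
  induction 1; [reflexivity|now apply App_red|now apply Lam_red|].
  transitivity (App (Lam M') N').
  - apply App_red; [now apply Lam_red|easy].
  - apply rt_step, beta_redex.
Qed.

Lemma par_rename M N : par M N -> forall r, par (rename r M) (rename r N).
Proof.
  induction 1; simpl; intros r; try (constructor; auto; fail).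
  replace (rename r (subst (scons N' Var) M')) with
    (subst (scons (rename r N') Var) (rename (scons 0 (fun x => S (r x))) M')).
  - now constructor.
  - rewrite rename_subst, subst_rename. apply subst_ext. now intros [|x].
Qed.

Lemma par_subst M N : par M N ->
  forall s t, (forall x, par (s x) (t x)) -> par (subst s M) (subst t N).
Proof.
  assert (Hup : forall s t, (forall x, par (s x) (t x)) -> forall x, par (up s x) (up t x)).
  { intros s t H [|x]; simpl; [constructor|now apply par_rename]. }
  induction 1; simpl; intros s t Hst; auto; try (constructor; auto; fail).
  rewrite subst_up_scons. constructor; auto.
Qed.

(** Takahashi's complete development: all redexes present in the term are contracted at once. *)
Fixpoint dev (M : term) : term :=
  match M with
  | Var x => Var x
  | App (Lam M) N => subst (scons (dev N) Var) (dev M)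
  | App M N => App (dev M) (dev N)
  | Lam M => Lam (dev M)
  end.

(** A parallel step contracts some of the redexes of [M]; contracting what remains of the others
    leads to [dev M]. Since the target depends on [M] alone, this yields the diamond property. *)
Lemma par_dev M N : par M N -> par N (dev M).
Proof.
  induction 1 as [x|M M' N N' HM IHM HN IHN|M M' HM IHM|M M' N N' HM IHM HN IHN];
    simpl; try (constructor; auto; fail).
  - destruct M; try (constructor; auto; fail).
    inversion HM; subst. inversion IHM; subst. now constructor.
  - apply par_subst; [easy|]. intros [|x]; simpl; [easy|constructor].
Qed.

Notation pars := (clos_refl_trans_1n term par).

Lemma pars_strip M N P : par M P -> pars M N -> exists Q, pars P Q /\ par N Q.
Proof.
  intros HP HN. revert P HP.
  induction HN as [M|M M' N HM HN IH]; intros P HP.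
  - exists P. split; [constructor|easy].
  - destruct (IH (dev M) (par_dev _ _ HM)) as [Q [H1 H2]].
    exists Q. split; [|easy]. econstructor; [apply par_dev, HP|exact H1].
Qed.

Lemma pars_confluent M N P : pars M N -> pars M P -> exists Q, pars N Q /\ pars P Q.
Proof.
  intros HN. revert P. induction HN as [M|M M' N HM HN IH]; intros P HP.
  - exists P. split; [easy|constructor].
  - destruct (pars_strip M P M' HM HP) as [Q [H1 H2]].
    destruct (IH Q H1) as [R [H3 H4]].
    exists R. split; [easy|]. econstructor; eassumption.
Qed.

Lemma red_pars M N : red M N <-> pars M N.
Proof.
  split; intros H.
  - apply clos_rt_rt1n.
    induction H; [apply rt_step; now apply beta_par|apply rt_refl|eapply rt_trans; eassumption].
  - induction H; [reflexivity|]. etransitivity; [apply par_red; eassumption|easy].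
Qed.

Theorem church_rosser M N : conv M N -> exists P, red M P /\ red N P.
Proof.
  induction 1 as [M N H|M|M N H [P [H1 H2]]|M N P HN [Q1 [H1 H2]] HP [Q2 [H3 H4]]].
  - exists N. split; [now apply rt_step|reflexivity].
  - now exists M.
  - now exists P.
  - apply red_pars in H2, H3.
    destruct (pars_confluent _ _ _ H2 H3) as [Q [H5 H6]]. apply red_pars in H5, H6.
    exists Q. split; etransitivity; eassumption.
Qed.

(** * Head normal forms and Böhm trees *)

Lemma apps_snoc M Ns N : apps M (Ns ++ [N]) = App (apps M Ns) N.
Proof. unfold apps. now rewrite fold_left_app. Qed.

Lemma apps_Var_not_Lam y Ns M : apps (Var y) Ns <> Lam M.
Proof.
  destruct Ns as [|N Ns _] using rev_ind; [easy|]. now rewrite apps_snoc.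
Qed.

Lemma apps_Var_inj y y' Ns : forall Ns',
  apps (Var y) Ns = apps (Var y') Ns' -> y = y' /\ Ns = Ns'.
Proof.
  induction Ns as [|N Ns IH] using rev_ind; intros Ns' H;
    destruct Ns' as [|N' Ns' _] using rev_ind; rewrite ?apps_snoc in H; simpl in H;
    try discriminate.
  - injection H as ->. easy.
  - injection H as H ->. apply IH in H as [-> ->]. easy.
Qed.

Lemma lams_apps_Var_inj n : forall n' y y' Ns Ns',
  lams n (apps (Var y) Ns) = lams n' (apps (Var y') Ns') -> n = n' /\ y = y' /\ Ns = Ns'.
Proof.
  induction n as [|n IH]; intros [|n'] y y' Ns Ns' H; simpl in H.
  - apply apps_Var_inj in H. easy.
  - now apply apps_Var_not_Lam in H.
  - symmetry in H. now apply apps_Var_not_Lam in H.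
  - injection H as H. apply IH in H. intuition.
Qed.

Lemma Forall2_red_refl Ns : Forall2 red Ns Ns.
Proof. induction Ns; constructor; [reflexivity|easy]. Qed.

Lemma beta_apps_Var y Ns : forall P, beta (apps (Var y) Ns) P ->
  exists Ns', P = apps (Var y) Ns' /\ Forall2 red Ns Ns'.
Proof.
  induction Ns as [|N Ns IH] using rev_ind; intros P H; rewrite ?apps_snoc in H.
  - inversion H.
  - inversion H as [M N0 E|M M' N0 HM|M N0 N' HN|]; subst.
    + symmetry in E. now apply apps_Var_not_Lam in E.
    + apply IH in HM as [Ns' [-> HNs]]. exists (Ns' ++ [N]). rewrite apps_snoc.
      split; [easy|]. apply Forall2_app; [easy|apply Forall2_red_refl].
    + exists (Ns ++ [N']). rewrite apps_snoc. split; [easy|].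
      apply Forall2_app; [apply Forall2_red_refl|]. repeat constructor. easy.
Qed.

Lemma beta_lams_apps_Var n : forall y Ns P, beta (lams n (apps (Var y) Ns)) P ->
  exists Ns', P = lams n (apps (Var y) Ns') /\ Forall2 red Ns Ns'.
Proof.
  induction n as [|n IH]; simpl; intros y Ns P H.
  - now apply beta_apps_Var.
  - inversion H as [| | |M M' HM]; subst. apply IH in HM as [Ns' [-> HNs]].
    now exists Ns'.
Qed.

Lemma Forall2_trans {A} (R : A -> A -> Prop) : Transitive R -> Transitive (Forall2 R).
Proof.
  intros HR l1 l2 l3 H. revert l3. induction H; intros l3 H3; inversion H3; subst;
    constructor; [etransitivity; eassumption|auto].
Qed.

Lemma red_lams_apps_Var n y Ns P : red (lams n (apps (Var y) Ns)) P ->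
  exists Ns', P = lams n (apps (Var y) Ns') /\ Forall2 red Ns Ns'.
Proof.
  intros H. apply clos_rt_rt1n in H. remember (lams n (apps (Var y) Ns)) as M eqn:E.
  revert Ns E. induction H as [M|M M' P HM _ IH]; intros Ns ->.
  - exists Ns. split; [easy|apply Forall2_red_refl].
  - apply beta_lams_apps_Var in HM as [Ns1 [-> H1]].
    destruct (IH Ns1 eq_refl) as [Ns2 [-> H2]]. exists Ns2. split; [easy|].
    eapply Forall2_trans; [exact _|eassumption..].
Qed.

Lemma Forall2_red_conv Ns Ns' P : Forall2 red Ns P -> Forall2 red Ns' P -> Forall2 conv Ns Ns'.
Proof.
  intros H. revert Ns'. induction H as [|N Q Ns P HN HNs IH]; intros Ns' H'; inversion H'; subst;
    constructor; auto.
  transitivity Q; [|symmetry]; now apply red_conv.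
Qed.

(** Reduction of a head normal form takes place in its arguments only, so the common reduct given by
    Church-Rosser retains the prefix and the head of both. *)
Lemma hnf_unique M n y Ns n' y' Ns' :
  hnf_of M n y Ns -> hnf_of M n' y' Ns' -> n = n' /\ y = y' /\ Forall2 conv Ns Ns'.
Proof.
  unfold hnf_of. intros H H'. rewrite H in H'. apply church_rosser in H' as [P [H1 H2]].
  apply red_lams_apps_Var in H1 as [P1 [-> H1]], H2 as [P2 [E H2]].
  apply lams_apps_Var_inj in E as [-> [-> ->]].
  repeat split. eapply Forall2_red_conv; eassumption.
Qed.

Lemma hnf_of_unary M x N : conv M (App (Var x) N) -> hnf_of M 0 x [N].
Proof. easy. Qed.

Lemma hnf_of_unary_unique M x N n y Ns :
  conv M (App (Var x) N) -> hnf_of M n y Ns -> n = 0 /\ y = x /\ exists N', Ns = [N'] /\ conv N' N.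
Proof.
  intros H H'. destruct (hnf_unique _ _ _ _ _ _ _ H' (hnf_of_unary _ _ _ H)) as [-> [-> HN]].
  repeat split. inversion HN as [|N' ? Ns' ? H1 H2]; subst. inversion H2; subst. now exists N'.
Qed.

Lemma bohm_tree_conv M M' p l : conv M M' -> bohm_tree M p l -> bohm_tree M' p l.
Proof.
  intros H HM. destruct HM as [M HM|M n y Ns HM|M n y Ns i N p l HM Hi HN].
  - constructor. intros [n [y [Ns HN]]]. apply HM. exists n, y, Ns.
    unfold hnf_of in *. now rewrite H.
  - constructor. unfold hnf_of in *. now rewrite <- H.
  - apply (bt_child _ n y Ns i N); auto. unfold hnf_of in *. now rewrite <- H.
Qed.

(** The root label exposes one [x], and its argument has the same infinite spine, so the hypothesis
    reproduces itself one level down. *)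
Lemma bohm_tree_spine_unfold x k : forall M,
  (forall j, bohm_tree M (repeat 0 j) (Node 0 x 1)) ->
  exists N, conv M (Nat.iter k (App (Var x)) N).
Proof.
  induction k as [|k IH]; intros M H.
  - now exists M.
  - assert (H0 := H 0). inversion H0 as [|M0 n y Ns HM|]; subst.
    destruct Ns as [|N [|]]; try discriminate.
    destruct (IH N) as [N' HN'].
    + intros j. assert (Hj := H (S j)). simpl in Hj.
      inversion Hj as [| |M1 n y Ns i N1 p l HM1 Hi HN1]; subst.
      destruct (hnf_of_unary_unique _ _ _ _ _ _ HM HM1) as [-> [-> [N2 [-> HN2]]]].
      injection Hi as ->. eapply bohm_tree_conv; eassumption.
    + exists N'. simpl. rewrite <- HN'. exact HM.
Qed.

(** In the tree of [x (Y x)] the only child is the tree of [Y x]; equality of the two trees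
    therefore carries a label of [Y x] from depth [j] to depth [S j]. *)
Lemma wfpc_unfold Y x k : wfpc Y -> ~ free x Y ->
  exists N, conv (App Y (Var x)) (Nat.iter k (App (Var x)) N).
Proof.
  intros HY Hx. apply bohm_tree_spine_unfold. intros j.
  induction j as [|j IH]; apply HY; auto; simpl.
  - apply (bt_root _ 0 x [App Y (Var x)]), hnf_of_unary. reflexivity.
  - apply (bt_child _ 0 x [App Y (Var x)] 0 (App Y (Var x))); auto.
    apply hnf_of_unary. reflexivity.
Qed.

(** The right-hand side does not mention [c], so all members of the family share one Böhm tree. [M]
    ranges over all terms convertible to [T c] because arguments of head normal forms are known only
    up to conversion. *)
Lemma bohm_tree_stream x (T : nat -> term) :
  (forall c, conv (T c) (App (Var x) (T (S c)))) ->
  forall M c p l, conv M (T c) ->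
  (bohm_tree M p l <-> p = repeat 0 (length p) /\ l = Node 0 x 1).
Proof.
  intros HT M c p l HM. split.
  - intros H. revert c HM.
    induction H as [M H|M n y Ns H|M n y Ns i N p l H Hi HN IH]; intros c HM.
    + destruct H. exists 0, x, [T (S c)]. apply hnf_of_unary. now rewrite HM.
    + rewrite HT in HM.
      now destruct (hnf_of_unary_unique _ _ _ _ _ _ HM H) as [-> [-> [N [-> _]]]].
    + rewrite HT in HM.
      destruct (hnf_of_unary_unique _ _ _ _ _ _ HM H) as [-> [-> [N' [-> HN']]]].
      destruct i as [|[|i]]; try discriminate. injection Hi as ->.
      destruct (IH (S c) HN') as [E ->]. split; [|easy]. simpl. now f_equal.
  - intros [-> ->]. generalize (length p) as j. intros j. revert M c HM.
    induction j as [|j IH]; intros M c HM; rewrite HT in HM; simpl.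
    + exact (bt_root M 0 x [T (S c)] HM).
    + apply (bt_child M 0 x [T (S c)] 0 (T (S c)) _ _ HM eq_refl).
      apply (IH _ (S c)). reflexivity.
Qed.

(** * Fixed point combinators under substitution; compact vectors are rectifying *)

Lemma fpc_of_fresh Y x :
  ~ free x Y -> conv (App Y (Var x)) (App (Var x) (App Y (Var x))) -> fpc Y.
Proof.
  intros Hx H y _. apply (conv_subst (single x (Var y))) in H. simpl in H.
  now rewrite subst_single_fresh, single_eq in H.
Qed.

Lemma fpc_subst_conv Y Z s : fpc Y -> conv Z (subst s Y) -> fpc Z.
Proof.
  intros HY HZ.
  destruct (fresh_var [Y]) as [y Hy]. inversion Hy; subst.
  destruct (fresh_var [Z]) as [x Hx]. inversion Hx; subst.
  apply (fpc_of_fresh Z x); [easy|].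
  specialize (HY y ltac:(easy)).
  (* As [y] is not free in [Y], this substitution acts on [Y] as [s] does, while the test variable
     [y] becomes [x], which is fresh for [Z]. *)
  apply (conv_subst (fun v => if Nat.eq_dec v y then Var x else s v)) in HY. simpl in HY.
  destruct (Nat.eq_dec y y) as [_|]; [|easy].
  rewrite (subst_ext_free Y _ s), <- HZ in HY; [easy|].
  intros v Hv. destruct (Nat.eq_dec v y); congruence.
Qed.

Lemma compact_rectifying G0 Gs : compact G0 Gs -> rectifying G0 Gs.
Proof.
  intros HG Y HY. destruct (fresh_var (G0 :: Gs)) as [z Hz].
  destruct (HG z Hz) as [k Hk]. inversion Hz as [|? ? Hz0 Hzs]; subst.
  destruct (fresh_var [Y]) as [x Hx]. inversion Hx as [|? ? HxY _]; subst.
  destruct (wfpc_unfold Y x k HY HxY) as [N HN].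
  (* Putting [G0] for [x] in [Y x = x^k(N)] gives [Y G0 = G0^k(N[x := G0])]. *)
  apply (conv_subst (single x G0)) in HN. simpl in HN.
  rewrite subst_iter, subst_single_fresh in HN by easy. simpl in HN.
  rewrite single_eq in HN.
  (* Filling the hole [z] of the compact form with [N[x := G0]] leaves the vector itself
     unchanged. *)
  apply (fpc_subst_conv _ _ (single z (subst (single x G0) N)) Hk).
  rewrite subst_apps, subst_iter, map_subst_single_fresh, subst_single_fresh by easy.
  simpl. rewrite single_eq. now apply (conv_apps Gs (App Y G0)).
Qed.

(** * A wfpc whose unfoldings are counted *)

Definition counter (z c : nat) : term := Nat.iter c (App (Var z)) (Var z).

(** [λc a x. x (a (z c) a x)] *)
Definition unfolder (z : nat) : term :=
  Lam (Lam (Lam (App (Var 0) (App (App (App (Var 1) (App (Var (3 + z)) (Var 2))) (Var 1)) (Var 0))))).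

Definition counted (z c : nat) : term := App (App (unfolder z) (counter z c)) (unfolder z).

(** An unfolding of [counted z c] takes two beta steps. This is the contractum of the first, the
    redex [A c]; it gets a name because a reduction may stop between the two. *)
Definition unfolder_at (z c : nat) : term :=
  Lam (Lam (App (Var 0) (App (App (App (Var 1) (counter (2 + z) (S c))) (Var 1)) (Var 0)))).

Definition counted_unfolded (z c : nat) : term := Lam (App (Var 0) (App (counted (S z) (S c)) (Var 0))).

Lemma rename_counter r z c : rename r (counter z c) = counter (r z) c.
Proof. unfold counter. induction c; simpl; f_equal; auto. Qed.

Lemma subst_counter s z z' c : s z = Var z' -> subst s (counter z c) = counter z' c.
Proof. intros H. unfold counter. rewrite subst_iter. simpl. now rewrite H. Qed.

Lemma subst_unfolder s z z' : s z = Var z' -> subst s (unfolder z) = unfolder z'.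
Proof. intros H. unfold unfolder. simpl. now rewrite H. Qed.

Lemma subst_unfolder_at s z z' c : s z = Var z' -> subst s (unfolder_at z c) = unfolder_at z' c.
Proof.
  intros H. unfold unfolder_at. simpl. rewrite H. simpl.
  now rewrite (subst_counter _ _ (2 + z')) by (simpl; now rewrite H).
Qed.

Lemma unfolder_redex z c :
  subst (scons (counter z c) Var)
    (Lam (Lam (App (Var 0) (App (App (App (Var 1) (App (Var (3 + z)) (Var 2))) (Var 1)) (Var 0)))))
  = unfolder_at z c.
Proof. simpl. now rewrite !rename_counter. Qed.

Lemma unfolder_at_redex z c :
  subst (scons (unfolder z) Var)
    (Lam (App (Var 0) (App (App (App (Var 1) (counter (2 + z) (S c))) (Var 1)) (Var 0))))
  = counted_unfolded z c.
Proof.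
  unfold counted_unfolded, counted. simpl. now rewrite (subst_counter _ _ (S z)).
Qed.

Lemma counted_conv z c : conv (counted z c) (counted_unfolded z c).
Proof.
  unfold counted. rewrite (beta_conv _ (counter z c) _ (eq_sym (unfolder_redex z c))).
  apply beta_conv. symmetry. apply unfolder_at_redex.
Qed.

Lemma counted_step z c N : conv (App (counted z c) N) (App N (App (counted z (S c)) N)).
Proof.
  rewrite counted_conv at 1. apply beta_conv. simpl.
  now rewrite (subst_counter _ _ z).
Qed.

Lemma wfpc_counted z : wfpc (counted z 0).
Proof.
  intros x _ p l.
  (* The sequence is shifted by one so that both sides of the wfpc equation belong to it: [x (Y x)]
     is [T 0] and [Y x] is [T 1]. *)
  set (T := fun c => match c with 0 => App (Var x) (App (counted z 0) (Var x))
                                | S c => App (counted z c) (Var x) end).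
  assert (HT : forall c, conv (T c) (App (Var x) (T (S c)))).
  { intros [|c]; simpl; [reflexivity|apply counted_step]. }
  rewrite (bohm_tree_stream x T HT _ 1), (bohm_tree_stream x T HT _ 0) by reflexivity.
  reflexivity.
Qed.

(** * Truncating the counted wfpc *)

(** The counter variable [z] is reused as the innermost argument, where it becomes the variable in
    the definition of [compact]. *)
Definition truncated (z k : nat) : term := Lam (Nat.iter k (App (Var 0)) (Var (S z))).

Lemma subst_truncated s z z' k : s z = Var z' -> subst s (truncated z k) = truncated z' k.
Proof. intros H. unfold truncated. simpl. rewrite subst_iter. simpl. now rewrite H. Qed.

Lemma truncated_conv z k N : conv (App (truncated z k) N) (Nat.iter k (App N) (Var z)).
Proof. apply beta_conv. now rewrite subst_iter. Qed.

(** [n] bounds the counters in the left-hand term.  The variable [z] is allowed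
    only inside counters, so two reductions to the same term cannot disagree on
    where, and with which counter, to truncate. *)
Inductive truncates (K : nat) : nat -> nat -> term -> term -> Prop :=
| tr_var n z y : y <> z -> truncates K n z (Var y) (Var y)
| tr_app n z M M' N N' :
    truncates K n z M M' -> truncates K n z N N' -> truncates K n z (App M N) (App M' N')
| tr_lam n z M M' : truncates K n (S z) M M' -> truncates K n z (Lam M) (Lam M')
| tr_counted n z c : c <= n -> truncates K n z (counted z c) (truncated z (K - c))
| tr_unfolding n z c :
    c <= n -> truncates K n z (App (unfolder_at z c) (unfolder z)) (truncated z (K - c)).

Lemma truncates_mono K n m z M M' : n <= m -> truncates K n z M M' -> truncates K m z M M'.
Proof. intros Hm H. induction H; constructor; auto; lia. Qed.

Lemma truncates_refl K n z M : ~ free z M -> truncates K n z M M.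
Proof.
  revert z. induction M as [x|M IHM N IHN|M IHM]; simpl; intros z H; constructor; auto.
Qed.

(** Here [z] is applied to a bound variable, outside any counter, where [tr_var] excludes it. Hence
    [tr_app] never overlaps with [tr_counted] or [tr_unfolding]. *)
Lemma truncates_unfolder K n z M : ~ truncates K n z (unfolder z) M.
Proof.
  intros H. unfold unfolder in H.
  inversion H as [| |? ? ? ? E1| |]; subst.
  inversion E1 as [| |? ? ? ? E2| |]; subst.
  inversion E2 as [| |? ? ? ? E3| |]; subst.
  inversion E3 as [|? ? ? ? ? ? _ E4| | |]; subst.
  inversion E4 as [|? ? ? ? ? ? E5| | |]; subst.
  inversion E5 as [|? ? ? ? ? ? E6| | |]; subst.
  inversion E6 as [|? ? ? ? ? ? _ E7| | |]; subst.
  inversion E7 as [|? ? ? ? ? ? E8| | |]; subst.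
  inversion E8; easy.
Qed.

Lemma counter_inj z c c' : counter z c = counter z c' -> c = c'.
Proof.
  revert c'. induction c as [|c IH]; intros [|c'] H; try easy.
  injection H as H. f_equal. now apply IH.
Qed.

(** The shape of [P] determines the constructor, and its counter determines the truncation. The
    bounds [n] and [m] may differ, since two reductions to [P] may differ in length. *)
Lemma truncates_functional K n m z P P1 P2 :
  truncates K n z P P1 -> truncates K m z P P2 -> P1 = P2.
Proof.
  intros H. revert P2 m.
  induction H as [n z y Hy|n z M M' N N' HM IHM HN IHN|n z M M' HM IHM|n z c Hc|n z c Hc];
    intros P2 m H2.
  - now inversion H2.
  - inversion H2; subst.
    + f_equal; eauto.
    + now apply truncates_unfolder in HN.
    + now apply truncates_unfolder in HN.
  - inversion H2; subst. f_equal. eauto.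
  - remember (counted z c) as Q eqn:E. destruct H2; try easy.
    + injection E as -> ->. now apply truncates_unfolder in H2_0.
    + injection E as E. apply counter_inj in E. now subst.
  - remember (App (unfolder_at z c) (unfolder z)) as Q eqn:E. destruct H2; try easy.
    + injection E as -> ->. now apply truncates_unfolder in H2_0.
    + injection E as E. apply (counter_inj (2 + z) c0 c) in E. now subst.
Qed.

(** All three terms are closed apart from [z], so a substitution can only rename that variable. *)
Lemma truncates_subst_counted K n z z' c s s' :
  s z = Var z' -> s' z = Var z' -> c <= n ->
  truncates K n z' (subst s (counted z c)) (subst s' (truncated z (K - c))) /\
  truncates K n z' (subst s (App (unfolder_at z c) (unfolder z))) (subst s' (truncated z (K - c))).
Proof.
  intros Hs Hs' Hc. unfold counted. cbn [subst].
  rewrite (subst_unfolder _ _ z'), (subst_counter _ _ z'), (subst_unfolder_at _ _ z'),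
    (subst_truncated _ _ z') by easy.
  split; [now apply (tr_counted K)|now apply (tr_unfolding K)].
Qed.

Lemma truncates_rename K n z M M' : truncates K n z M M' -> forall r,
  (forall y, y <> z -> r y <> r z) -> truncates K n (r z) (rename r M) (rename r M').
Proof.
  induction 1 as [n z y Hy|n z M M' N N' HM IHM HN IHN|n z M M' HM IHM|n z c Hc|n z c Hc];
    intros r Hr.
  - constructor. auto.
  - constructor; auto.
  - constructor. apply (IHM (scons 0 (fun x => S (r x)))).
    intros [|y] Hy; simpl; [easy|]. specialize (Hr y). lia.
  - rewrite !rename_as_subst. now apply truncates_subst_counted.
  - rewrite !rename_as_subst. now apply truncates_subst_counted.
Qed.

Lemma truncates_subst K n z M M' : truncates K n z M M' -> forall s s' z',
  s z = Var z' -> s' z = Var z' ->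
  (forall y, y <> z -> truncates K n z' (s y) (s' y)) ->
  truncates K n z' (subst s M) (subst s' M').
Proof.
  induction 1 as [n z y Hy|n z M M' N N' HM IHM HN IHN|n z M M' HM IHM|n z c Hc|n z c Hc];
    intros s s' z' Hs Hs' H.
  - now apply H.
  - cbn [subst]. constructor; auto.
  - cbn [subst]. constructor. apply IHM.
    + simpl. now rewrite Hs.
    + simpl. now rewrite Hs'.
    + intros [|y] Hy; simpl; [now constructor|].
      apply (truncates_rename K n z'); [apply H; congruence|lia].
  - now apply truncates_subst_counted.
  - now apply truncates_subst_counted.
Qed.

(** * Simulation of beta reduction under truncation *)

Lemma counter_normal z c M : ~ beta (counter z c) M.
Proof.
  revert M. induction c as [|c IH]; intros M H; inversion H as [|? ? ? H1|? ? ? H1|]; subst.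
  - inversion H1.
  - now apply IH in H1.
Qed.

Ltac invert_beta :=
  repeat match goal with
  | H : beta (counter _ _) _ |- _ => now apply counter_normal in H
  | H : beta _ _ |- _ => progress (inversion H; clear H; subst)
  end.

Lemma unfolder_normal z M : ~ beta (unfolder z) M.
Proof. unfold unfolder. intros H. invert_beta. Qed.

Lemma unfolder_at_normal z c M : ~ beta (unfolder_at z c) M.
Proof. unfold unfolder_at. intros H. invert_beta. Qed.

(** The strict bound guarantees that [x^(K-c)(z)] still has an outermost [x] to split off. *)
Lemma truncated_step z K c : c < K ->
  conv (truncated z (K - c)) (Lam (App (Var 0) (App (truncated (S z) (K - S c)) (Var 0)))).
Proof.
  intros Hc. rewrite truncated_conv. replace (K - c) with (S (K - S c)) by lia. reflexivity.
Qed.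

Lemma truncates_counted_unfolded K n z c : c <= n ->
  truncates K (S n) z (counted_unfolded z c)
    (Lam (App (Var 0) (App (truncated (S z) (K - S c)) (Var 0)))).
Proof.
  intros Hc. constructor. constructor; [now constructor|].
  constructor; [|now constructor]. apply (tr_counted K). lia.
Qed.

(** An ordinary step is copied. The first half of an unfolding leaves the truncation unchanged; the
    second splits off one [x] and raises the counter by one, whence the bound [S n]. *)
Lemma truncates_beta K n z M M' N : truncates K n z M M' -> n < K -> beta M N ->
  exists N', truncates K (S n) z N N' /\ conv M' N'.
Proof.
  intros H HK. revert N.
  induction H as [n z y Hy|n z M M' N N' HM IHM HN IHN|n z M M' HM IHM|n z c Hc|n z c Hc];
    intros P HP.
  - inversion HP.
  - apply (truncates_mono K n (S n)) in HN as HN'; [|lia].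
    apply (truncates_mono K n (S n)) in HM as HM'; [|lia].
    inversion HP as [M0 N0|M0 M1 N0 H1|M0 N0 N1 H1|]; subst.
    + inversion HM' as [| |? ? ? M1 HM1| |]; subst.
      exists (subst (scons N' Var) M1). split; [|now apply beta_conv].
      (* Under the abstraction the marked variable is [S z], and contracting the redex lowers it to
         [z] again. *)
      apply (truncates_subst K _ (S z) _ _ HM1); simpl; [easy..|].
      intros [|y] Hy; simpl; [easy|]. constructor. congruence.
    + destruct (IHM HK _ H1) as [Q [HQ HC]]. exists (App Q N').
      split; [now constructor|]. now rewrite HC.
    + destruct (IHN HK _ H1) as [Q [HQ HC]]. exists (App M' Q).
      split; [now constructor|]. now rewrite HC.
  - inversion HP as [| | |M0 M1 H1]; subst.
    destruct (IHM HK _ H1) as [Q [HQ HC]]. exists (Lam Q).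
    split; [now constructor|]. now rewrite HC.
  - exists (truncated z (K - c)). split; [|reflexivity].
    inversion HP as [|M0 M1 N0 H1|M0 N0 N1 H1|]; subst; [|now apply unfolder_normal in H1].
    inversion H1 as [M0 N0|M0 M2 N0 H2|M0 N0 N1 H2|]; subst;
      [|now apply unfolder_normal in H2|now apply counter_normal in H2].
    rewrite unfolder_redex. apply (tr_unfolding K). lia.
  - exists (Lam (App (Var 0) (App (truncated (S z) (K - S c)) (Var 0)))).
    split; [|apply truncated_step; lia].
    inversion HP as [M0 N0|M0 M1 N0 H1|M0 N0 N1 H1|]; subst;
      [|now apply unfolder_at_normal in H1|now apply unfolder_normal in H1].
    assert (E := truncates_counted_unfolded K n z c Hc).
    rewrite <- unfolder_at_redex in E. exact E.
Qed.

(** [k] bounds the number of steps and depends on the reduction alone, so [K] may be chosen after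
    it. *)
Lemma truncates_red M N : red M N -> exists k, forall K n z M',
  n + k <= K -> truncates K n z M M' -> exists N', truncates K (n + k) z N N' /\ conv M' N'.
Proof.
  induction 1 as [M N H|M|M N P _ [k1 H1] _ [k2 H2]].
  - exists 1. intros K n z M' HK HM. rewrite Nat.add_1_r in *. eapply truncates_beta; eassumption.
  - exists 0. intros K n z M' _ HM. exists M'. rewrite Nat.add_0_r. now split.
  - exists (k1 + k2). intros K n z M' HK HM.
    destruct (H1 K n z M' ltac:(lia) HM) as [N' [HN HMN]].
    destruct (H2 K (n + k1) z N' ltac:(lia) HN) as [P' [HP HNP]].
    exists P'. split; [now rewrite Nat.add_assoc|now rewrite HMN].
Qed.

Lemma truncates_conv M N : conv M N -> exists K, forall z M' N',
  truncates K 0 z M M' -> truncates K 0 z N N' -> conv M' N'.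
Proof.
  intros H. apply church_rosser in H as [P [HM HN]].
  apply truncates_red in HM as [k HM], HN as [l HN].
  (* This [K] is large enough for both reductions, whose final truncations of [P] then coincide by
     functionality. *)
  exists (k + l). intros z M' N' H1 H2.
  destruct (HM (k + l) 0 z M' ltac:(lia) H1) as [P1 [HP1 HC1]].
  destruct (HN (k + l) 0 z N' ltac:(lia) H2) as [P2 [HP2 HC2]].
  rewrite HC1, HC2, (truncates_functional _ _ _ _ _ _ _ HP1 HP2). reflexivity.
Qed.

Lemma truncates_apps_fresh K n z Ns : Forall (fun N => ~ free z N) Ns ->
  forall M M', truncates K n z M M' -> truncates K n z (apps M Ns) (apps M' Ns).
Proof.
  induction 1 as [|N Ns HN HNs IH]; intros M M' HM; simpl; [easy|].
  apply (IH (App M N)). constructor; [easy|]. now apply truncates_refl.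
Qed.

(** * Rectifying vectors are compact *)

Lemma rectifying_compact G0 Gs : rectifying G0 Gs -> compact G0 Gs.
Proof.
  intros HG z Hz.
  specialize (HG (counted z 0) (wfpc_counted z)).
  destruct (fresh_var (Var z :: counted z 0 :: G0 :: Gs)) as [x Hx].
  inversion Hx as [|? ? Hxz Hx1]; subst. inversion Hx1 as [|? ? HxY HxG]; subst.
  inversion HxG as [|? ? HxG0 HxGs]; subst. simpl in Hxz.
  assert (HF : ~ free x (apps (counted z 0) (G0 :: Gs))).
  { rewrite free_apps. intros [H|H]; [easy|]. revert H. now apply Forall_Exists_neg. }
  destruct (truncates_conv _ _ (HG x HF)) as [K HK]. clear HG HF.
  assert (HT : truncates K 0 z (apps (counted z 0) (G0 :: Gs)) (apps (truncated z K) (G0 :: Gs))).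
  (* The initial counter is 0, so the truncation keeps all [K] copies, written [K - 0] to match
     [tr_counted]. *)
  { apply truncates_apps_fresh; [easy|]. rewrite <- (Nat.sub_0_r K) at 2. now apply tr_counted. }
  assert (Hx0 : truncates K 0 z (Var x) (Var x)) by now constructor.
  (* Both sides of the fixed point equation are truncated; as [x] differs from [z], it survives
     unchanged. *)
  assert (HC := HK z _ _ (tr_app _ _ _ _ _ _ _ HT Hx0)
    (tr_app _ _ _ _ _ _ _ Hx0 (tr_app _ _ _ _ _ _ _ HT Hx0))).
  exists K. apply (fpc_of_fresh _ x).
  - rewrite free_apps. intros [H|H].
    + now apply free_iter in H as [H|H].
    + revert H. now apply Forall_Exists_neg.
  - rewrite <- (conv_apps Gs _ _ (truncated_conv z K G0)). exact HC.
Qed.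

Theorem theorem5p3 (G0 : term) (Gs : list term) (hG : fgv G0 Gs) :
  compact G0 Gs <-> rectifying G0 Gs.
Proof.
  split; [apply compact_rectifying|apply rectifying_compact].
Qed.
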